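(* Let $\alpha\in(0,2)$, let $\mathcal N$ be a standard Gaussian random variable and let $\mathcal S^{(\alpha/2)}$ be a spectrally positive $\alpha/2$-stable random variable, independent of $\mathcal N$, with Laplace transform $\mathbf E\, e^{-\lambda \mathcal S^{(\alpha/2)}}=e^{-\Gamma(1-\frac{\alpha}{2})\lambda^{\alpha/2}}$, $\lambda\ge0$. Then $$\limsup_{x\to+\infty}x^{-\alpha}\ln\mathbf P\Big(\frac{|\mathcal N|}{\sqrt{\mathcal S^{(\alpha/2)}}}>x\Big)<0,$$ and in particular, for all $\sigma>0$ and $\theta_0>0$, all moments of the random variable $\sigma\sqrt{2\theta_0}\cdot\mathcal N/\sqrt{\mathcal S^{(\alpha/2)}}$ are finite.
   Context: $\Gamma$ denotes the Gamma function. *)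

(* Defs.v *)
From HB Require Import structures.
From mathcomp Require Import all_boot all_order all_algebra.
From mathcomp Require Import all_classical all_reals all_analysis.

Set Implicit Arguments.
Unset Strict Implicit.
Unset Printing Implicit Defensive.

Import Order.TTheory GRing.Theory Num.Theory.
Import numFieldNormedType.Exports.

Local Open Scope classical_set_scope.
Local Open Scope ring_scope.

(* Euler's integral; meaningful for 0 < s only: the real-valued integral
   is 0 when the integrand is not integrable. *)
Definition Gamma (R : realType) (s : R) : R :=
  \int[lebesgue_measure]_(t in `]0, +oo[) (t `^ (s - 1) * expR (- t)).

Definition independent_RV d (T : measurableType d) (R : realType)
    (P : probability T R) (X Y : {RV P >-> R}) : Prop :=
  forall A B : set R, measurable A -> measurable B ->
    P (X @^-1` A `&` Y @^-1` B) = (P (X @^-1` A) * P (Y @^-1` B))%E.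

Definition standard_gaussian d (T : measurableType d) (R : realType)
    (P : probability T R) (X : {RV P >-> R}) : Prop :=
  forall A : set R, measurable A ->
    distribution P X A = normal_prob (0 : R) 1 A.

(* X has the a-stable law with scale c, skewness b and location m, i.e.
     E exp(i u X)
       = exp(- c^a |u|^a (1 - i b sgn(u) tan(pi a / 2)) + i m u),
   the real and imaginary parts being written out separately.  This is the
   parametrization for a in ]0, 2[ with a != 1. *)
Definition stable_law d (T : measurableType d) (R : realType)
    (P : probability T R) (X : {RV P >-> R}) (a c b m : R) : Prop :=
  forall u : R,
    let r := c `^ a * `|u| `^ a in
    let t := m * u + b * r * Num.sg u * tan (pi * a / 2) in
    ('E_P[fun w => cos (u * X w)%R] = (expR (- r) * cos t)%:E)%E /\
    ('E_P[fun w => sin (u * X w)%R] = (expR (- r) * sin t)%:E)%E.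

(* The Levy measure of a non-degenerate (c > 0) stable law is carried by
   ]0, +oo[ exactly when the skewness is 1. *)
Definition spectrally_positive_stable d (T : measurableType d) (R : realType)
    (P : probability T R) (X : {RV P >-> R}) (a : R) : Prop :=
  exists c m : R, 0 < c /\ stable_law X a c 1 m.

(* All absolute moments, of any real order p >= 0; for a random
   variable X, equivalently, X ^+ k is integrable for every natural k. *)
Definition all_moments_finite d (T : measurableType d) (R : realType)
    (P : probability T R) (X : T -> R) : Prop :=
  forall p : R, 0 <= p -> ('E_P[fun w => (`|X w| `^ p)%R] < +oo)%E.

(* Main.v *)
Require Import Defs.
From HB Require Import structures.
From mathcomp Require Import all_boot all_order all_algebra.
From mathcomp Require Import all_classical all_reals all_analysis.
From mathcomp Require Import measurable_realfun ring lra.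
Import Order.TTheory GRing.Theory Num.Theory.
Import numFieldNormedType.Exports.
Local Open Scope classical_set_scope.
Local Open Scope ring_scope.

(** Given a value [S > 0], the event [|N| / sqrt S > x] is the Gaussian tail
    event [|N| > x sqrt S], of probability at most [sqrt 2 * exp (- x^2 S / 4)];
    given [S <= 0] it is empty for [x >= 0], the quotient being 0. Averaging over [S] gives a value of its Laplace transform
    ([gaussian_ratio_tail]):
      [P (|N| / sqrt S > x) <= sqrt 2 * E exp (- (x^2 / 4) S)
         = sqrt 2 * exp (- G (x^2 / 4)^(alpha/2))
         = sqrt 2 * exp (- c x^alpha)]
    with [G = Gamma (1 - alpha/2)] and [c = G / 4^(alpha/2)]. As [c > 0], the
    limit superior is negative ([limf_esup_log_tail]).

    The constant [G] is nonnegative as the integral of a nonnegative function.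
    It is not 0 because the stable law is not degenerate: [G = 0] would make the
    Laplace transform of [S] identically 1 ([laplace_stable_constant_neq0]).

    For the moments, the variable [Y = |sigma sqrt (2 theta0) N / sqrt S|^alpha]
    has an exponential tail by the same bound, hence finite moments of every
    nonnegative order ([exponential_tail_moment_lty]); the absolute moment of
    order [p] is the moment of [Y] of order [p / alpha]. *)

(** * Measurability *)

Lemma measurable_superlevel d (T : measurableType d) (R : realType)
    (f : T -> R) (y : R) :
  measurable_fun setT f -> measurable [set w | y < f w].
Proof.
move=> mf; rewrite (_ : [set w | _] = f @^-1` `]y, +oo[).
  by rewrite -[X in measurable X]setTI; exact: mf.
by apply/seteqP; split => w /=; rewrite in_itv /= andbT.
Qed.

Lemma measurable_fun_div_sqrt d (T : measurableType d) (R : realType)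
    (f g : T -> R) :
  measurable_fun setT f -> measurable_fun setT g ->
  measurable_fun setT (fun w => `|f w| / Num.sqrt (g w)).
Proof.
move=> mf mg; apply: measurable_funM; first exact: measurableT_comp.
(* inversion is a power function on the range of the square root *)
rewrite (_ : (fun _ => _) = (fun w => Num.sqrt (g w) `^ (-1))); last first.
  by apply/funext => w; rewrite powR_inv1 // sqrtr_ge0.
apply: (measurableT_comp (@measurable_powR R (-1))).
apply: measurableT_comp mg.
by apply: continuous_measurable_fun; exact: sqrt_continuous.
Qed.

Lemma measurable_fun_expRNZ d (T : measurableType d) (R : realType)
    (l : R) (f : T -> R) :
  measurable_fun setT f -> measurable_fun setT (fun w => expR (- (l * f w))).
Proof.
move=> mf; apply: measurableT_comp => //; apply: measurableT_comp => //.
exact: measurable_funM.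
Qed.

(** * Tail of the ratio of a Gaussian variable and a square root *)

(** Exponential Markov inequality at rate 1/4: multiplying the standard density
    by [exp (n^2/4)] gives [sqrt 2] times the centred density of variance 2, so
    that no integral has to be computed. *)
Lemma gaussian_tail (R : realType) (y : R) : 0 <= y ->
  (normal_prob (0 : R) 1 [set n | (y < `|n|)%R]
    <= (Num.sqrt 2 * expR (- (y ^+ 2 / 4)))%:E)%E.
Proof.
move=> y0; set D := [set n : R | _].
have mD : measurable (D : set (measurableTypeR R)).
  exact: (@measurable_superlevel _ (measurableTypeR R)).
pose s : R := Num.sqrt 2.
have s0 : s != 0 by rewrite gt_eqF // sqrtr_gt0.
have s2 : s ^+ 2 = 2 by rewrite sqr_sqrtr.
pose K := s * expR (- (y ^+ 2 / 4)).
have K0 : 0 <= K by rewrite mulr_ge0 ?expR_ge0 ?sqrtr_ge0.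
(* both densities have centre 0, their peaks have ratio s, and
   n^2/2 >= y^2/4 + n^2/4 on D *)
have pdf_le n : D n -> normal_pdf 0 1 n <= K * normal_pdf 0 s n.
  rewrite /D /= => yn.
  have yn2 : y ^+ 2 <= n ^+ 2.
    by rewrite -(real_normK (num_real n)) ler_sqr ?nnegrE // ltW.
  rewrite !normal_pdfE ?oner_neq0 // /normal_peak /normal_fun.
  have -> : (s ^+ 2 * pi *+ 2 : R) = 2 * (1 ^+ 2 * pi *+ 2).
    by rewrite s2 expr1n; ring.
  rewrite s2 sqrtrM // -/s invfM subr0 expr1n.
  set q := (Num.sqrt (1 * pi *+ 2))^-1.
  have q0 : 0 <= q by rewrite invr_ge0 sqrtr_ge0.
  have -> : K * (s^-1 * q * expR (- n ^+ 2 / (2 *+ 2)))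
     = q * (expR (- (y ^+ 2 / 4)) * expR (- n ^+ 2 / (2 *+ 2))).
    by rewrite /K; field.
  rewrite -expRD ler_wpM2l // ler_expR.
  have -> : (2 *+ 2 : R) = 4 by ring.
  by lra.
rewrite /normal_prob.
have mpdf t : measurable_fun (setT : set (measurableTypeR R)) (normal_pdf (0 : R) t).
  exact: measurable_normal_pdf.
apply: (@le_trans _ _
    (\int[lebesgue_measure]_(x in D) (K * normal_pdf 0 s x)%:E)%E).
  apply: ge0_le_integral => //.
  - by move=> x _; rewrite lee_fin normal_pdf_ge0.
  - by apply/measurable_EFinP/measurable_funTS.
  - apply/measurable_EFinP/measurable_funTS.
    exact: (measurable_funM (measurable_cst K) (mpdf s)).
apply: (@le_trans _ _
    (\int[lebesgue_measure]_x (K * normal_pdf 0 s x)%:E)%E).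
  apply: ge0_subset_integral => //.
  - apply/measurable_EFinP.
    exact: (measurable_funM (measurable_cst K) (mpdf s)).
  - by move=> x _; rewrite lee_fin mulr_ge0 // normal_pdf_ge0.
under eq_integral do rewrite EFinM.
rewrite ge0_integralZl_EFin //; last 2 first.
  - by move=> x _; rewrite lee_fin normal_pdf_ge0.
  - exact/measurable_EFinP.
by rewrite integral_normal_pdf mule1.
Qed.

(** The product rule on rectangles identifies the law of [(Y, X)] with the
    product of the two laws; slicing the product measure then lets one condition
    on [Y] by holding its value fixed. *)
Lemma independent_RV_section d (T : measurableType d) (R : realType)
    (P : probability T R) (X Y : {RV P >-> R}) (A : set (R * R)) :
  independent_RV X Y -> measurable A ->
  (P [set w | A (Y w, X w)]
    = \int[distribution P Y]_y distribution P X (xsection A y))%E.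
Proof.
move=> indep mA.
have mYX : measurable_fun setT (fun w => (Y w, X w)).
  by apply/measurable_fun_pairP; split; exact: measurable_funPT.
pose YX : {mfun T >-> (R * R)%type} := HB.pack (fun w => (Y w, X w))
  (isMeasurableFun.Build _ _ _ _ _ mYX).
rewrite -[LHS]/(distribution P YX A).
rewrite -(@product_measure_unique _ _ _ _ R (distribution P Y) (distribution P X)) //.
move=> B C mB mC; rewrite muleC -[RHS]indep //.
by congr (P _); apply/seteqP; split=> w [].
Qed.

(** Conditionally on [S = s > 0] the event is [|N| > x sqrt s], whose
    probability is at most [sqrt 2 * exp (- x^2 s / 4)]; integrating in [s] turns
    the tail of the ratio into a value of the Laplace transform of [S]. *)
Lemma gaussian_ratio_tail d (T : measurableType d) (R : realType)
    (P : probability T R) (N S : {RV P >-> R}) (x : R) :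
  standard_gaussian N -> independent_RV N S -> 0 <= x ->
  (P [set w | (x < `|N w| / Num.sqrt (S w))%R]
    <= (Num.sqrt 2)%:E * 'E_P[fun w => expR (- (x ^+ 2 / 4 * S w))])%E.
Proof.
move=> gaussN indep x0.
pose A := [set sn : R * R | x < `|sn.2| / Num.sqrt sn.1].
have mA : measurable A.
  apply: (@measurable_superlevel _ _ _
    (fun sn : R * R => `|sn.2| / Num.sqrt sn.1)).
  exact: measurable_fun_div_sqrt.
pose f (s : R) := Num.sqrt 2 * expR (- (x ^+ 2 / 4 * s)).
have f0 s : 0 <= f s by rewrite mulr_ge0 ?expR_ge0 ?sqrtr_ge0.
have mf : measurable_fun setT (EFin \o f).
  apply/measurable_EFinP; apply: measurable_funM => //.
  exact: measurable_fun_expRNZ.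
have section_le s : (distribution P N (xsection A s) <= (f s)%:E)%E.
  rewrite gaussN; last exact: measurable_xsection.
  have xsE : xsection A s = [set n | x < `|n| / Num.sqrt s].
    by apply/seteqP; split => n; rewrite /xsection /A /= inE.
  (* for s <= 0 the quotient is 0 by the conventions on square root and
     inverse, so the section is empty because 0 <= x *)
  have [s0|s0] := leP s 0.
    rewrite xsE (_ : [set n | _] = set0) ?measure0 ?lee_fin //.
    apply/seteqP; split => n //=.
    by rewrite ler0_sqrtr // invr0 mulr0 ltNge x0.
  have -> : xsection A s = [set n | x * Num.sqrt s < `|n|].
    rewrite xsE; apply/seteqP; split => n /=;
      by rewrite ltr_pdivlMr // sqrtr_gt0.
  apply: le_trans (gaussian_tail _ _ _) _; first by rewrite mulr_ge0 ?sqrtr_ge0.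
  by rewrite lee_fin /f exprMn sqr_sqrtr ?(ltW s0) // mulrAC.
rewrite (@independent_RV_section _ _ _ P N S A) //.
apply: (@le_trans _ _ (\int[distribution P S]_s (f s)%:E)%E).
  apply: ge0_le_integral => //.
  exact: measurable_fun_xsection.
rewrite ge0_integral_distribution // unlock /=.
rewrite /f; under eq_integral do rewrite /= EFinM.
rewrite ge0_integralZl_EFin ?sqrtr_ge0 //.
exact/measurable_EFinP/measurable_fun_expRNZ.
Qed.

(** * Nondegeneracy of the stable law *)

(** If the constant vanished, [E e^(-S)] and [E e^(-2S)] would both equal 1, so
    [e^(-S)] would have variance 0 and [S] would be almost surely 0; this
    contradicts the characteristic function of a stable law of positive scale. *)
Lemma laplace_stable_constant_neq0 d (T : measurableType d) (R : realType)
    (P : probability T R) (S : {RV P >-> R}) (a k : R) :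
  spectrally_positive_stable S a ->
  (forall l : R, 0 <= l ->
    ('E_P[fun w => expR (- (l * S w))] = (expR (- (k * l `^ a)))%:E)%E) ->
  k != 0.
Proof.
move=> [c [m [c0 stableS]]] laplaceS; apply/eqP => k0.
have laplace1 l : 0 <= l -> (\int[P]_w (expR (- (l * S w)))%:E = 1)%E.
  by move=> l0; have := laplaceS l l0; rewrite unlock k0 mul0r oppr0 expR0.
have mexp l : measurable_fun setT (fun w => (expR (- (l * S w)))%:E).
  exact/measurable_EFinP/measurable_fun_expRNZ.
(* E (e^(-S) - 1)^2 = E e^(-2S) - 2 E e^(-S) + 1 = 0; below the negative term
   is moved to the other side so that all integrands are nonnegative *)
pose h w := ((expR (- (1 * S w)) - 1) ^+ 2)%R.
have mh : measurable_fun setT (EFin \o h).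
  apply/measurable_EFinP; apply: measurable_funX; apply: measurable_funB => //.
  exact: measurable_fun_expRNZ.
have inth : (\int[P]_w (h w)%:E = 0)%E.
  have : (\int[P]_w ((h w)%:E + (2 * expR (- (1 * S w)))%:E)
     = \int[P]_w ((expR (- (2 * S w)))%:E + (cst 1 w)%:E))%E.
    apply: eq_integral => w _; rewrite -!EFinD; congr EFin.
    have -> : - (2 * S w) = - (1 * S w) + - (1 * S w) by ring.
    by rewrite expRD /h /cst; ring.
  have e0 (l : R) w : (0 <= (expR (- (l * S w)))%:E)%E by rewrite lee_fin expR_ge0.
  rewrite ge0_integralD //=; last 2 first.
  - by move=> w _; rewrite lee_fin sqr_ge0.
  - apply/measurable_EFinP; apply: measurable_funM => //.
    exact: measurable_fun_expRNZ.
  rewrite ge0_integralD //=.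
  under [X in (_ + X)%E]eq_integral do rewrite EFinM.
  rewrite ge0_integralZl_EFin // !laplace1 // integral_cst //= probability_setT.
  rewrite !mule1.
  case: (\int[P]_w _)%E => [r| |] //= /eqP; rewrite -!EFinD eqe => /eqP r2.
  by congr EFin; lra.
have S0 : ae_eq P setT (EFin \o h) (cst 0%E).
  apply/ae_eq_integral_abs => //.
  rewrite -[RHS]inth; apply: eq_integral => w _ /=.
  by rewrite ger0_norm // sqr_ge0.
have := (stableS 1).1; rewrite unlock.
have -> : (\int[P]_w (cos (1 * S w))%:E = 1)%E.
  transitivity (\int[P]_w (cst 1%E w))%E; last first.
    by rewrite integral_cst //= probability_setT mule1.
  apply: ae_eq_integral => //.
    apply/measurable_EFinP; apply: (@measurableT_comp _ _ _ _ _ _ cos).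
      by apply: continuous_measurable_fun; exact: continuous_cos.
    exact: measurable_funM.
  apply: filterS S0 => w /= + _ => /(_ I) -[] /eqP.
  rewrite sqrf_eq0 subr_eq0 mul1r -[X in _ == X -> _]expR0 => /eqP/expR_inj/eqP.
  by rewrite oppr_eq0 => /eqP ->; rewrite cos0.
(* at u = 1 the real part is at most e^(-r) < 1, against E cos S = 1 *)
set r := c `^ a * _; set t := m * 1 + _.
have r0 : 0 < r by rewrite mulr_gt0 // powR_gt0 // normr1.
case => e1.
have : expR (- r) * cos t <= expR (- r).
  by rewrite ler_piMr ?expR_ge0 // cos_le1.
rewrite -e1 leNgt => /negP; apply.
by rewrite expR_lt1 oppr_lt0.
Qed.

(** * Logarithmic limit superior of a stretched exponential tail *)

Lemma limf_esup_pinfty_le (R : realType) (f : R -> \bar R) (m b : R) :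
  (forall x, m < x -> (f x <= b%:E)%E) ->
  (limf_esup f (pinfty_nbhs R) <= b%:E)%E.
Proof.
move=> fb; rewrite limf_esupE; apply: ge_ereal_inf.
exists (ereal_sup (f @` [set x | m < x])); last first.
  by apply: ge_ereal_sup => _ [x /= mx <-]; exact: fb.
exists [set x | m < x] => //.
by exists m; split => //; exact: num_real.
Qed.

Lemma powRK (R : realType) (a x : R) : a != 0 -> 0 <= x ->
  (x `^ a) `^ a^-1 = x.
Proof. by move=> a0 x0; rewrite -powRrM divff // powRr1. Qed.

(** After taking logarithms the prefactor [K] contributes [ln K / x^a], which
    vanishes at infinity; half of [c] is spent to absorb it for large [x]. *)
Lemma limf_esup_log_tail (R : realType) (p : R -> \bar R) (K c a : R) :
  0 < a -> 0 < c -> 1 <= K -> (forall x, (0 <= p x)%E) ->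
  (forall x, 0 <= x -> (p x <= (K * expR (- (c * x `^ a)))%:E)%E) ->
  (limf_esup (fun x : R => (x `^ (- a))%:E * lne (p x)) (pinfty_nbhs R)
    <= (- (c / 2))%:E)%E.
Proof.
move=> a0 c0 K1 p0 ptail.
have K0 : 0 < K by exact: lt_le_trans K1.
have L0 : 0 <= 2 * ln K / c by rewrite divr_ge0 ?mulr_ge0 ?ln_ge0 // ltW.
apply: (@limf_esup_pinfty_le _ _ ((2 * ln K / c) `^ a^-1)) => x mx.
have x0 : 0 < x by apply: le_lt_trans mx; exact: powR_ge0.
have xa0 : 0 < x `^ a by exact: powR_gt0.
have Lx : 2 * ln K / c <= x `^ a.
  rewrite -[leLHS](@powRK _ a^-1) ?invr_neq0 ?gt_eqF // invrK.
  by apply: ge0_ler_powR; rewrite ?nnegrE ?powR_ge0 // ltW.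
apply: (@le_trans _ _ ((x `^ (- a))%:E * (ln K - c * x `^ a)%:E)%E).
  rewrite lee_wpmul2l ?lee_fin ?powR_ge0 //.
  have Kx0 : 0 < K * expR (- (c * x `^ a)) by rewrite mulr_gt0 ?expR_gt0.
  have -> : (ln K - c * x `^ a)%:E = lne (K * expR (- (c * x `^ a)))%:E.
    by rewrite lne_EFin // lnM ?posrE ?expR_gt0 // expRK.
  rewrite lee_lne ?ptail ?(ltW x0) // in_itv /= ?leey ?p0 //.
  by rewrite lee_fin ltW.
rewrite -EFinM lee_fin powRN mulrC ler_pdivrMr //.
move: Lx; rewrite ler_pdivrMr //.
by set X := x `^ a; lra.
Qed.

(** * Moments under an exponential tail *)

(** With [m > q], write [y = (m / b) u] where [u = b y / m], and use
    [u <= exp u]. *)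
Lemma powR_le_expR (R : realType) (b q : R) : 0 < b -> 0 <= q ->
  exists2 C, 0 <= C & forall y, 0 <= y -> y `^ q <= C * expR (b * y).
Proof.
move=> b0 q0.
(* q + 1 rather than q keeps m positive when q = 0 *)
pose m := q + 1; have m0 : 0 < m by rewrite ltr_wpDl.
exists ((m / b) `^ q); first exact: powR_ge0.
move=> y y0.
have mb0 : 0 <= m / b by rewrite divr_ge0 // ltW.
have u0 : 0 <= b * y / m by rewrite divr_ge0 ?mulr_ge0 // ltW.
have -> : y = m / b * (b * y / m) by field; rewrite !gt_eqF.
rewrite powRM // ler_wpM2l ?powR_ge0 //.
have -> : b * (m / b * (b * y / m)) = b * y / m * m by field; rewrite !gt_eqF.
rewrite expRM.
apply: (@le_trans _ _ (expR (b * y / m) `^ q)).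
  apply: ge0_ler_powR; rewrite ?nnegrE ?expR_ge0 //.
  by apply: le_trans (expR_ge1Dx _); rewrite lerDr.
by rewrite -!expRM ler_expR ler_wpM2l // /m lerDl.
Qed.

Lemma nneseries_geometric_lty (R : realType) (K z : R) :
  0 <= z < 1 -> (\sum_(0 <= n <oo) (K * z ^+ n)%:E < +oo)%E.
Proof.
move=> /andP[z0 z1].
have := @cvg_geometric_series R K z; rewrite ger0_norm // => /(_ z1) cvgs.
suff -> : (\sum_(0 <= n <oo) (K * z ^+ n)%:E)%E = (K * (1 - z)^-1)%:E.
  by rewrite ltry.
apply: cvg_lim => //.
under eq_fun do rewrite sumEFin.
by apply: cvg_EFin => //; exact: nearW.
Qed.

(** Slicing at the integers, [exp (h Y)] is at most a constant plus the sum of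
    [exp (h (n + 2))] over the [n < Y]. For [h = b / 2] the expectation of this
    sum is dominated by a geometric series of ratio [exp (- h)], and powers are
    dominated by [exp (h Y)]. *)
Lemma exponential_tail_moment_lty d (T : measurableType d) (R : realType)
    (P : probability T R) (Y : T -> R) (K b q : R) :
  measurable_fun setT Y -> (forall w, 0 <= Y w) -> 0 < b -> 0 <= q ->
  (forall n : nat,
    (P [set w | (n%:R < Y w)%R] <= (K * expR (- (b * n%:R)))%:E)%E) ->
  ('E_P[fun w => (Y w `^ q)%R] < +oo)%E.
Proof.
move=> mY Y0 b0 q0 tailY.
(* half of the decay rate is given up to make the series summable *)
pose h := b / 2; have h0 : 0 < h by rewrite divr_gt0.
have [C C0 powC] := powR_le_expR _ _ _ h0 q0.
pose A n := [set w | n%:R < Y w].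
have mA n : measurable (A n) by exact: measurable_superlevel.
pose g n w : \bar R := (C * expR (h * n.+2%:R) * \1_(A n) w)%:E.
have g0 n w : (0 <= g n w)%E.
  by rewrite lee_fin mulr_ge0 // mulr_ge0 ?expR_ge0.
have mg n : measurable_fun setT (g n).
  by apply/measurable_EFinP; exact: measurable_funM.
have Yg w : ((Y w `^ q)%:E <= (C * expR h)%:E + \sum_(0 <= n <oo) g n w)%E.
  (* only the term n = floor (Y w) - 1 is used: there n < n.+1 <= Y w < n.+2;
     the constant covers Y w < 1 *)
  have sum0 : (0 <= \sum_(0 <= n <oo) g n w)%E by exact: nneseries_ge0.
  have := truncn_itv (Y0 w).
  case: (Num.truncn (Y w)) => [|n] /andP[nY Yn].
    apply: (@le_trans _ _ (C * expR h)%:E); last exact: leeDl.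
    rewrite lee_fin (le_trans (powC _ (Y0 w))) // ler_wpM2l // ler_expR.
    by rewrite ler_piMr ?(ltW h0) // ltW.
  apply: (@le_trans _ _ (g n w)).
    rewrite /g indicE mem_set ?mulr1; last first.
      by rewrite /A /= (lt_le_trans _ nY) // ltr_nat.
    rewrite lee_fin (le_trans (powC _ (Y0 w))) // ler_wpM2l // ler_expR.
    by rewrite ler_wpM2l ?(ltW h0) // ltW.
  apply: (@le_trans _ _ (\sum_(0 <= n <oo) g n w)%E); last first.
    by rewrite leeDr // lee_fin mulr_ge0 ?expR_ge0.
  apply: le_trans (nneseries_lim_ge n.+1 _) => //.
  by rewrite big_nat_recr //= leeDr // sume_ge0.
rewrite unlock.
apply: (@le_lt_trans _ _
   (\int[P]_w ((C * expR h)%:E + \sum_(0 <= n <oo) g n w))%E).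
  apply: ge0_le_integral => //.
  - by move=> w _; rewrite lee_fin powR_ge0.
  - apply/measurable_EFinP; exact: (measurableT_comp (@measurable_powR R q)).
  - apply: emeasurable_funD => //; exact: ge0_emeasurable_sum.
rewrite ge0_integralD //; last 3 first.
- by move=> w _; rewrite lee_fin mulr_ge0 ?expR_ge0.
- by move=> w _; exact: nneseries_ge0.
- exact: ge0_emeasurable_sum.
rewrite integral_cst //= probability_setT mule1 lte_add_pinfty ?ltry //.
rewrite integral_nneseries //.
pose K' := C * expR (h * 2) * K.
apply: (@le_lt_trans _ _ (\sum_(0 <= n <oo) (K' * expR (- h) ^+ n)%:E)%E).
  apply: lee_nneseries => [n _ _|n _]; first exact: integral_ge0.
  have c0 : 0 <= C * expR (h * n.+2%:R) by rewrite mulr_ge0 ?expR_ge0.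
  under eq_integral do rewrite /g EFinM.
  rewrite ge0_integralZl_EFin //; last exact/measurable_EFinP.
  rewrite integral_indic // setIT.
  apply: (@le_trans _ _ ((C * expR (h * n.+2%:R))%:E * (K * expR (- (b * n%:R)))%:E)%E).
    by rewrite lee_wpmul2l // tailY.
  have e : expR (h * n.+2%:R) * expR (- (b * n%:R))
      = expR (h * 2) * expR (- h) ^+ n.
    by rewrite -expRM_natr -!expRD -addn2 natrD /h; congr expR; field.
  by rewrite -EFinM lee_fin /K' mulrACA e mulrACA mulrA lexx.
by apply: nneseries_geometric_lty; rewrite expR_ge0 expR_lt1 oppr_lt0.
Qed.

(** * The Gaussian variable divided by the root of a stable one *)

Theorem mainTheorem4 (R : realType) (d : measure_display)
    (T : measurableType d) (P : probability T R) (alpha : R)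
    (N S : {RV P >-> R})
    (halpha : 0 < alpha < 2)
    (hN : standard_gaussian N)
    (hS : spectrally_positive_stable S (alpha / 2))
    (hLaplace : forall l : R, 0 <= l ->
      ('E_P[fun w => expR (- (l * S w))]
        = (expR (- (Gamma (1 - alpha / 2) * l `^ (alpha / 2))))%:E)%E)
    (hindep : independent_RV N S) :
  (limf_esup
     (fun x : R => (x `^ (- alpha))%:E *
        lne (P [set w | (x < `|N w| / Num.sqrt (S w))%R]))
     (pinfty_nbhs R) < 0)%E
  /\
  (forall sigma theta0 : R, 0 < sigma -> 0 < theta0 ->
     all_moments_finite P
       (fun w => sigma * Num.sqrt (2 * theta0) * (N w / Num.sqrt (S w)))).
Proof.
have /andP[alpha0 _] := halpha.
pose G := Gamma (1 - alpha / 2).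
have G0 : 0 < G.
  (* nonnegativity is that of the integrand: a divergent integral would
     count as 0 *)
  rewrite lt_neqAle eq_sym (laplace_stable_constant_neq0 _ _ _ _ _ _ _ hS hLaplace).
  by apply: Rintegral_ge0 => t _; rewrite mulr_ge0 ?powR_ge0 ?expR_ge0.
pose c := G * 4^-1 `^ (alpha / 2).
have c0 : 0 < c by rewrite mulr_gt0 ?powR_gt0.
have tail x : 0 <= x ->
    (P [set w | (x < `|N w| / Num.sqrt (S w))%R]
      <= (Num.sqrt 2 * expR (- (c * x `^ alpha)))%:E)%E.
  move=> x0; apply: le_trans (gaussian_ratio_tail _ _ _ _ _ _ _ hN hindep x0) _.
  rewrite hLaplace ?divr_ge0 ?sqr_ge0 // -EFinM lee_fin.
  rewrite powRM ?sqr_ge0 // -(powR_mulrn 2 x0) -powRrM.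
  have -> : 2 * (alpha / 2) = alpha by field.
  by rewrite [X in G * X]mulrC mulrA.
split.
  apply: (@le_lt_trans _ _ (- (c / 2))%:E); last first.
    by rewrite lte_fin oppr_lt0 divr_gt0.
  apply: limf_esup_log_tail tail => //.
  by rewrite -[leLHS]sqrtr1 ler_sqrt // ler1n.
move=> sigma theta0 sigma0 theta00 p p0.
set D := sigma * _; have D0 : 0 < D by rewrite mulr_gt0 ?sqrtr_gt0 ?mulr_gt0.
clearbody D.
pose Z w := `|N w| / Num.sqrt (S w).
have mZ : measurable_fun setT Z by exact: measurable_fun_div_sqrt.
have Z0 w : 0 <= Z w by rewrite divr_ge0 ?sqrtr_ge0.
(* the power alpha turns the tail of D * Z into an exponential one *)
pose Y w := (D * Z w) `^ alpha.
have -> : (fun w => `|D * (N w / Num.sqrt (S w))| `^ p)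
    = (fun w => Y w `^ (p / alpha)).
  apply/funext => w; rewrite /Y -powRrM.
  rewrite [alpha * _]mulrCA divff ?gt_eqF // mulr1.
  by rewrite !normrM normfV (gtr0_norm D0) (ger0_norm (sqrtr_ge0 _)).
apply: (@exponential_tail_moment_lty _ _ _ _ Y (Num.sqrt 2) (c * D^-1 `^ alpha)).
- apply: (measurableT_comp (@measurable_powR R alpha)).
  exact: measurable_funM.
- by move=> w; exact: powR_ge0.
- by rewrite mulr_gt0 ?powR_gt0 ?invr_gt0.
- by rewrite divr_ge0 // ltW.
move=> n; pose x := D^-1 * n%:R `^ alpha^-1.
have x0 : 0 <= x by rewrite mulr_ge0 ?powR_ge0 // invr_ge0 ltW.
apply: (@le_trans _ _ (P [set w | x < Z w])).
  apply: le_measure; rewrite ?inE.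
  - apply: (@measurable_superlevel _ _ _ Y).
    apply: (measurableT_comp (@measurable_powR R alpha)).
    exact: measurable_funM.
  - exact: measurable_superlevel.
  move=> w /= nY; rewrite /x ltr_pdivrMl //.
  rewrite -[ltRHS](@powRK _ alpha) ?gt_eqF ?mulr_ge0 ?(ltW D0) //.
  by apply: gt0_ltr_powR; rewrite ?invr_gt0 ?nnegrE ?powR_ge0.
apply: le_trans (tail x x0) _; rewrite lee_fin.
rewrite /x powRM ?powR_ge0 ?invr_ge0 ?(ltW D0) // mulrA.
by rewrite -[n%:R `^ _ `^ _]powRrM mulVf ?gt_eqF // powRr1.
Qed.
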